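(* If two compact flat Riemannian manifolds have the same marked length spectrum, then they are isometric. That is, let $\Gamma,\Gamma'$ be Bieberbach groups and suppose there is a group isomorphism $\phi:\Gamma\to\Gamma'$ with $l(\phi(\gamma))=l(\gamma)$ for all $\gamma\in\Gamma$; then $M_\Gamma=\Gamma\backslash\mathbb{R}^n$ and $M_{\Gamma'}=\Gamma'\backslash\mathbb{R}^{n'}$ are isometric.
   Context: A Bieberbach group is a discrete, cocompact, torsion-free subgroup $\Gamma$ of the isometry group of some $\mathbb{R}^n$; $M_\Gamma=\Gamma\backslash\mathbb{R}^n$ is a compact flat Riemannian manifold with fundamental group $\Gamma$, and every compact flat manifold arises this way. Free homotopy classes of closed paths in $M_\Gamma$ correspond bijectively to conjugacy classes in $\Gamma$, and all closed geodesics in one free homotopy class have the same length; $l(\gamma)$ denotes this length for the class corresponding to $\gamma\in\Gamma$. Explicitly, writing $\gamma=BL_b$ with $B\in O(n)$ and $L_b$ translation by $b$ (so $\gamma x=B(x+b)$), $l(\gamma)=\|b_+\|$ where $b_+$ is the orthogonal projection of $b$ onto $\ker(B-\mathrm{Id})$. Two such manifolds have the same marked length spectrum if there is a length-preserving isomorphism between their fundamental groups. *)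

(* Defs.v *)
From HB Require Import structures.
From mathcomp Require Import all_boot all_order all_algebra.
From mathcomp Require Import all_classical all_reals all_analysis.

Set Implicit Arguments.
Unset Strict Implicit.
Unset Printing Implicit Defensive.

Import Order.TTheory GRing.Theory Num.Theory.
Import numFieldNormedType.Exports.

Local Open Scope classical_set_scope.
Local Open Scope ring_scope.
Local Open Scope quotient_scope.

Section Euclidean.
Variables (R : realType) (n : nat).
Implicit Types (u v w x y b : 'cV[R]_n) (V : set 'cV[R]_n).

Definition dot u v : R := (u^T *m v) 0 0.

(* The library norm on matrices is the sup norm, hence this one; both induce
   the same topology. *)
Definition enorm v : R := Num.sqrt (dot v v).

Definition orth_proj V b : 'cV[R]_n :=
  xget 0 [set w | V w /\ forall v, V v -> dot (b - w) v = 0].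

End Euclidean.

Section Isometries.
Variables (R : realType) (n : nat).

(* The pair (B, b) stands for B L_b, i.e. for x |-> B (x + b). *)
Record isom := Isom {
  isom_val : 'M[R]_n * 'cV[R]_n;
  isom_valP : isom_val.1^T *m isom_val.1 == 1%:M }.

HB.instance Definition _ := [isSub for isom_val].
HB.instance Definition _ := [Choice of isom by <:].
HB.instance Definition _ :=
  Topological.copy isom (initial_topology isom_val).

Definition linpart (g : isom) : 'M[R]_n := (isom_val g).1.
Definition trpart (g : isom) : 'cV[R]_n := (isom_val g).2.

Definition isom_act (g : isom) (x : 'cV[R]_n) : 'cV[R]_n :=
  linpart g *m (x + trpart g).

Lemma linpartTK g : (linpart g)^T *m linpart g = 1%:M.
Proof. exact/eqP/isom_valP. Qed.

Lemma linpartKT g : linpart g *m (linpart g)^T = 1%:M.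
Proof. exact/mulmx1C/linpartTK. Qed.

Lemma isom_one_subproof : (1%:M : 'M[R]_n)^T *m 1%:M == 1%:M.
Proof. by rewrite trmx1 mulmx1. Qed.

Definition isom_one : isom := @Isom (1%:M, 0) isom_one_subproof.

Lemma isom_inv_subproof g : (linpart g)^T^T *m (linpart g)^T == 1%:M.
Proof. by rewrite trmxK linpartKT. Qed.

Definition isom_inv g : isom :=
  @Isom ((linpart g)^T, - (linpart g *m trpart g)) (isom_inv_subproof g).

Lemma isom_mul_subproof g h :
  (linpart g *m linpart h)^T *m (linpart g *m linpart h) == 1%:M.
Proof.
by rewrite trmx_mul mulmxA -(mulmxA (linpart h)^T) linpartTK mulmx1 linpartTK.
Qed.

(* B (C (x + c) + b) = BC (x + c + C^-1 b) *)
Definition isom_mul g h : isom :=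
  @Isom (linpart g *m linpart h, trpart h + (linpart h)^T *m trpart g)
    (isom_mul_subproof g h).

Lemma isom_act1 x : isom_act isom_one x = x.
Proof. by rewrite /isom_act mul1mx addr0. Qed.

Lemma isom_actM g h x : isom_act (isom_mul g h) x = isom_act g (isom_act h x).
Proof.
rewrite /isom_act /= -mulmxA; congr (_ *m _).
by rewrite addrA mulmxDr mulmxA linpartKT mul1mx.
Qed.

Lemma isom_eqP g h :
  linpart g = linpart h -> trpart g = trpart h -> g = h.
Proof.
move: g h => [[B b] p] [[C c] q] /= e1 e2; apply: val_inj => /=.
by rewrite /linpart /trpart /= in e1 e2; rewrite e1 e2.
Qed.

Lemma isom_mulA : associative isom_mul.
Proof.
move=> f g h; apply: isom_eqP; first by rewrite /linpart /= -!mulmxA.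
by rewrite /trpart /= /linpart /= trmx_mul mulmxDr mulmxA addrA.
Qed.

Lemma isom_mul1g : left_id isom_one isom_mul.
Proof.
move=> g; apply: isom_eqP; first by rewrite /linpart /= mul1mx.
by rewrite /trpart /= mulmx0 addr0.
Qed.

Lemma isom_mulg1 : right_id isom_one isom_mul.
Proof.
move=> g; apply: isom_eqP; first by rewrite /linpart /= mulmx1.
by rewrite /trpart /= trmx1 mul1mx add0r.
Qed.

Lemma isom_mulVg : left_inverse isom_one isom_inv isom_mul.
Proof.
move=> g; apply: isom_eqP; first by rewrite /linpart /= linpartTK.
by rewrite /trpart /= mulmxN mulmxA linpartTK mul1mx subrr.
Qed.

Lemma isom_mulgV : right_inverse isom_one isom_inv isom_mul.
Proof.
move=> g; apply: isom_eqP; first by rewrite /linpart /= linpartKT.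
by rewrite /trpart /= /linpart /= trmxK addNr.
Qed.

HB.instance Definition _ := isGroup.Build isom
  isom_mulA isom_mul1g isom_mulg1 isom_mulVg isom_mulgV.

(* The length of the closed geodesics in the class of g. *)
Definition geolength (g : isom) : R :=
  enorm (orth_proj [set v | (linpart g - 1%:M) *m v = 0] (trpart g)).

(* For c(t) = x + t v with g (c 0) = c 1 and matching velocities, c projects to
   a closed geodesic of length enorm v in the class of g. *)
Lemma geolengthE g x v :
  isom_act g x = x + v -> linpart g *m v = v -> geolength g = enorm v.
Proof.
move=> gx gv; rewrite /geolength; congr enorm.
have ker u : (linpart g - 1%:M) *m u = 0 -> linpart g *m u = u.
  by rewrite mulmxBl mul1mx => /subr0_eq.
have dotg u w : dot (linpart g *m u) (linpart g *m w) = dot u w.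
  by rewrite /dot trmx_mul mulmxA -(mulmxA u^T) linpartTK mulmx1.
have dotB u w z : dot (u - w) z = dot u z - dot w z.
  by rewrite /dot linearB mulmxBl !mxE.
have dotD u w z : dot (u + w) z = dot u z + dot w z.
  by rewrite /dot linearD mulmxDl !mxE.
have vP : (linpart g - 1%:M) *m v = 0 /\ forall u,
    (linpart g - 1%:M) *m u = 0 -> dot (trpart g - v) u = 0.
  split; first by rewrite mulmxBl mul1mx gv subrr.
  move=> u /ker gu; have := dotg (x + trpart g) u.
  rewrite -/(isom_act g x) gx gu dotB !dotD => /addrI ->.
  by rewrite subrr.
rewrite /orth_proj; case: xgetP => [w _ [kw wP]|/(_ v)]; last by case.
have kwv : (linpart g - 1%:M) *m (w - v) = 0 by rewrite mulmxBr kw vP.1 subrr.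
have : dot (w - v) (w - v) = 0.
  have := wP _ kwv; rewrite dotB => /subr0_eq e1.
  by have := vP.2 _ kwv; rewrite !dotB => /subr0_eq e2; rewrite -e1 -e2 subrr.
rewrite /dot mxE => /eqP; rewrite psumr_eq0 => [/allP w0|i _]; last first.
  by rewrite mxE -expr2 sqr_ge0.
apply/subr0_eq/colP => i; rewrite [RHS]mxE; apply/eqP.
by have := w0 i (mem_index_enum i); rewrite /= [_^T _ _]mxE mulf_eq0 orbb.
Qed.

End Isometries.

Record subgroup (G : groupType) := Subgroup {
  subgroup_set :> set G;
  subgroup_closed : group_closed (mem subgroup_set) }.

Definition subgroup_app G (S : subgroup G) (g : G) : Prop := subgroup_set S g.
Coercion subgroup_app : subgroup >-> Funclass.

Section SubgroupTheory.
Variables (G : groupType) (S : subgroup G).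

Lemma subgroup1 : S 1%g.
Proof. by have [S1 _] := subgroup_closed S; exact: set_mem S1. Qed.

Lemma subgroupV g : S g -> S g^-1%g.
Proof.
move=> Sg; have := group_closedV (subgroup_closed S) (mem_set Sg).
exact: set_mem.
Qed.

Lemma subgroupM g h : S g -> S h -> S (g * h)%g.
Proof.
move=> Sg Sh.
have := group_closedM (subgroup_closed S) (mem_set Sg) (mem_set Sh).
exact: set_mem.
Qed.

End SubgroupTheory.

Section FlatManifold.
Variables (R : realType) (n : nat).
Implicit Types Gamma : subgroup (isom R n).

Definition discrete_subgroup Gamma : Prop := Gamma `<=` isolated Gamma.

Definition torsion_free Gamma : Prop :=
  forall g k, Gamma g -> (0 < k)%N -> (g ^+ k = 1)%g -> g = 1%g.

Definition orbit_rel Gamma : rel 'cV[R]_n :=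
  fun x y => `[< exists2 g, Gamma g & isom_act g x = y >].

Lemma orbit_rel_equiv Gamma : equiv_class_of (orbit_rel Gamma).
Proof.
have sym x y : orbit_rel Gamma x y -> orbit_rel Gamma y x.
  move=> /asboolP[g Gg <-]; apply/asboolP; exists g^-1%g; first exact: subgroupV.
  by rewrite -isom_actM isom_mulVg isom_act1.
split=> [x|x y|y x z].
- by apply/asboolP; exists 1%g; [exact: subgroup1|exact: isom_act1].
- by apply/idP/idP; exact: sym.
- move=> /asboolP[g Gg <-] /asboolP[h Gh <-].
  by apply/asboolP; exists (h * g)%g; [exact: subgroupM|exact: isom_actM].
Qed.

Canonical orbit_equiv Gamma := EquivRelPack (orbit_rel_equiv Gamma).

Definition flat_manifold Gamma :=
  quotient_topology {eq_quot orbit_equiv Gamma}.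

Definition flat_proj Gamma : 'cV[R]_n -> flat_manifold Gamma :=
  \pi_(flat_manifold Gamma).

Definition cocompact Gamma : Prop := compact [set: flat_manifold Gamma].

Definition bieberbach Gamma : Prop :=
  [/\ discrete_subgroup Gamma, cocompact Gamma & torsion_free Gamma].

End FlatManifold.

Section Smooth.
Variables (R : realType) (m n : nat).
Implicit Types (U : set 'cV[R]_m) (F : 'cV[R]_m -> 'cV[R]_n).

(* F is of class C^k on the open set U *)
Fixpoint class_C k U F : Prop :=
  if k is k'.+1 then
    (forall x, U x -> differentiable F x) /\
    (forall v, class_C k' U (fun x => 'd F x v))
  else forall x, U x -> {for x, continuous F}.

Definition smooth_near (x : 'cV[R]_m) F : Prop :=
  exists2 U, open_nbhs x U & forall k, class_C k U F.

End Smooth.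

(* The Riemannian structure of flat_manifold Gamma is the one for which
   flat_proj Gamma is a local isometry, so that local sections of flat_proj are
   isometric charts.  In such charts a map between flat manifolds is read as a
   local lift F, i.e. flat_proj Gamma' \o F = f \o flat_proj Gamma locally. *)
Section RiemannianIsometry.
Variables (R : realType) (m n : nat).
Variables (Gamma : subgroup (isom R m)) (Gamma' : subgroup (isom R n)).
Implicit Types f : flat_manifold Gamma -> flat_manifold Gamma'.

Definition local_lift f (x : 'cV[R]_m) (F : 'cV[R]_m -> 'cV[R]_n) : Prop :=
  smooth_near x F /\
  \forall y \near x, flat_proj Gamma' (F y) = f (flat_proj Gamma y).

Definition smooth_map f : Prop := forall x, exists F, local_lift f x F.

(* This does not depend on the lift F chosen, as two lifts differ locally by
   an element of Gamma'. *)
Definition preserves_metric f : Prop :=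
  forall x, exists2 F, local_lift f x F &
    forall u v, dot ('d F x u) ('d F x v) = dot u v.

End RiemannianIsometry.

Definition isometric (R : realType) (m n : nat)
    (Gamma : subgroup (isom R m)) (Gamma' : subgroup (isom R n)) : Prop :=
  exists (f : flat_manifold Gamma -> flat_manifold Gamma')
         (h : flat_manifold Gamma' -> flat_manifold Gamma),
    [/\ cancel f h, cancel h f, smooth_map f, smooth_map h
      & preserves_metric f].

(* Main.v *)
(* Bieberbach's first theorem: if al in Gamma has linear part A with
   |A - 1| <= 1/4 and d in Gamma has linear part within distance 1 of 1, the
   iterated commutators [... [d, al] ..., al] tend to 1, so by discreteness they
   reach 1; going back up, d preserves the axis of al, that is an affine
   subspace directed by ker (A - 1).  Cocompactness provides such d moving a
   given point in any prescribed direction, so ker (A - 1) is everything and al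
   is a translation.  Hence translations span, the point group is finite, and g
   is a translation iff it commutes with a positive power of every element, a
   condition that phi respects.

   On translations the length is the norm of the translation vector, so phi
   extends by polarization to a linear isometry T intertwining the linear parts
   of g and phi g.  The remaining discrepancy in translation parts is a cocycle
   on the finite point group, hence a coboundary, and correcting T by a
   translation gives a phi-equivariant isometry. *)
Require Import Defs.
From mathcomp Require Import all_boot all_order all_algebra.
From mathcomp Require Import all_classical all_reals all_analysis.
From mathcomp Require Import ring lra.

Set Implicit Arguments.
Unset Strict Implicit.
Unset Printing Implicit Defensive.

Import Order.TTheory GRing.Theory Num.Theory.
Import numFieldNormedType.Exports.

Local Open Scope classical_set_scope.
Local Open Scope ring_scope.

(** * Euclidean geometry *)

Section EuclideanTheory.
Variables (R : realType) (n : nat).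
Implicit Types (u v w x y : 'cV[R]_n) (A B C D : 'M[R]_n) (e f : R).

Lemma dotE u v : dot u v = \sum_i u i 0 * v i 0.
Proof. by rewrite /dot mxE; apply: eq_bigr => i _; rewrite mxE. Qed.

Lemma dotC u v : dot u v = dot v u.
Proof. by rewrite !dotE; apply: eq_bigr => i _; rewrite mulrC. Qed.

Lemma dotDl u v w : dot (u + v) w = dot u w + dot v w.
Proof. by rewrite /dot linearD mulmxDl mxE. Qed.

Lemma dotDr u v w : dot u (v + w) = dot u v + dot u w.
Proof. by rewrite /dot mulmxDr mxE. Qed.

Lemma dotNl u v : dot (- u) v = - dot u v.
Proof. by rewrite /dot linearN mulNmx mxE. Qed.

Lemma dotNr u v : dot u (- v) = - dot u v.
Proof. by rewrite /dot mulmxN mxE. Qed.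

Lemma dotBl u v w : dot (u - v) w = dot u w - dot v w.
Proof. by rewrite dotDl dotNl. Qed.

Lemma dotBr u v w : dot u (v - w) = dot u v - dot u w.
Proof. by rewrite dotDr dotNr. Qed.

Lemma dotZl a u v : dot (a *: u) v = a * dot u v.
Proof. by rewrite /dot linearZ -scalemxAl mxE. Qed.

Lemma dotZr a u v : dot u (a *: v) = a * dot u v.
Proof. by rewrite /dot -scalemxAr mxE. Qed.

Lemma dot0l u : dot 0 u = 0.
Proof. by rewrite -(scale0r 0) dotZl mul0r. Qed.

Lemma dot_ge0 u : 0 <= dot u u.
Proof. by rewrite dotE; apply: sumr_ge0 => i _; rewrite -expr2 sqr_ge0. Qed.

Lemma dot_eq0 u : (dot u u == 0) = (u == 0).
Proof.
apply/eqP/eqP => [|->]; last exact: dot0l.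
rewrite dotE => /eqP; rewrite psumr_eq0 => [/allP u0|i _]; last first.
  by rewrite -expr2 sqr_ge0.
apply/colP => i; rewrite mxE; apply/eqP.
by have := u0 i (mem_index_enum i); rewrite /= mulf_eq0 orbb.
Qed.

Lemma dot_gt0 u : u != 0 -> 0 < dot u u.
Proof. by move=> u0; rewrite lt_def dot_eq0 u0 dot_ge0. Qed.

Lemma enorm_ge0 u : 0 <= enorm u.
Proof. exact: sqrtr_ge0. Qed.

Lemma enorm_sqr u : enorm u ^+ 2 = dot u u.
Proof. by rewrite sqr_sqrtr // dot_ge0. Qed.

Lemma enorm0 : enorm (0 : 'cV[R]_n) = 0.
Proof. by rewrite /enorm dot0l sqrtr0. Qed.

Lemma enorm_gt0 u : u != 0 -> 0 < enorm u.
Proof. by move=> u0; rewrite sqrtr_gt0 dot_gt0. Qed.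

Lemma enormN u : enorm (- u) = enorm u.
Proof. by rewrite /enorm dotNl dotNr opprK. Qed.

Lemma enormBC u v : enorm (u - v) = enorm (v - u).
Proof. by rewrite -enormN opprB. Qed.

Lemma cauchy_schwarz u v : `|dot u v| <= enorm u * enorm v.
Proof.
have [->|u0] := eqVneq u 0; first by rewrite dot0l enorm0 mul0r normr0.
have uu := dot_gt0 u0.
rewrite -ler_sqr ?nnegrE ?mulr_ge0 ?enorm_ge0 //.
rewrite real_normK ?num_real // exprMn !enorm_sqr.
have := dot_ge0 (dot u u *: v - dot u v *: u).
rewrite dotBl !dotBr !dotZl !dotZr (dotC v u).
rewrite [X in 0 <= X](_ : _ = dot u u * (dot u u * dot v v - dot u v ^+ 2)).
  by rewrite pmulr_rge0 // subr_ge0.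
ring.
Qed.

Lemma ler_enormD u v : enorm (u + v) <= enorm u + enorm v.
Proof.
rewrite -ler_sqr ?nnegrE ?addr_ge0 ?enorm_ge0 //.
rewrite sqrrD !enorm_sqr dotDl !dotDr (dotC v u).
have := le_trans (ler_norm _) (cauchy_schwarz u v); lra.
Qed.

Lemma ler_enormB u v : enorm (u - v) <= enorm u + enorm v.
Proof. by rewrite -(enormN v) ler_enormD. Qed.

Lemma ler_coord_enorm u i : `|u i 0| <= enorm u.
Proof.
rewrite -ler_sqr ?nnegrE ?enorm_ge0 // enorm_sqr real_normK ?num_real //.
rewrite dotE (bigD1 i) //= -expr2 lerDl.
by apply: sumr_ge0 => j _; rewrite -expr2 sqr_ge0.
Qed.

Lemma enorm_le_sum u : enorm u <= \sum_i `|u i 0|.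
Proof.
rewrite -ler_sqr ?nnegrE ?enorm_ge0 ?sumr_ge0 // enorm_sqr dotE expr2.
rewrite mulr_suml; apply: ler_sum => i _.
rewrite (le_trans (ler_norm _)) // normrM ler_wpM2l //.
by rewrite (bigD1 i) //= lerDl sumr_ge0.
Qed.

Lemma dot_mulmx (m : nat) (T : 'M[R]_(m, n)) u v :
  T^T *m T = 1%:M -> dot (T *m u) (T *m v) = dot u v.
Proof. by move=> TT; rewrite /dot trmx_mul mulmxA -(mulmxA u^T) TT mulmx1. Qed.

Lemma enorm_mulmx (m : nat) (T : 'M[R]_(m, n)) u :
  T^T *m T = 1%:M -> enorm (T *m u) = enorm u.
Proof. by move=> TT; rewrite /enorm dot_mulmx. Qed.

Lemma dot_mulmxl A u v : dot (A *m u) v = dot u (A^T *m v).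
Proof. by rewrite /dot trmx_mul mulmxA. Qed.

(** The operator-norm bound |A - B| <= e. *)
Definition opdist_le A B e := forall x, enorm (A *m x - B *m x) <= e * enorm x.

Lemma opdist_leW A B e f : e <= f -> opdist_le A B e -> opdist_le A B f.
Proof.
by move=> ef AB x; rewrite (le_trans (AB x)) // ler_wpM2r ?enorm_ge0.
Qed.

Lemma opdist_le_of_entries A B e : 0 <= e ->
  (forall i j, `|A i j - B i j| <= e) -> opdist_le A B (e * n%:R * n%:R).
Proof.
move=> e0 AB x; rewrite -mulmxBl (le_trans (enorm_le_sum _)) //.
have -> : e * n%:R * n%:R * enorm x = \sum_(i < n) \sum_(j < n) e * enorm x.
  by rewrite !sumr_const !card_ord -mulrnA -[RHS]mulr_natl natrM; ring.
apply: ler_sum => i _; rewrite mxE (le_trans (ler_norm_sum _ _ _)) //.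
by apply: ler_sum => j _; rewrite normrM ler_pM ?ler_coord_enorm // !mxE AB.
Qed.

End EuclideanTheory.

(** * Orthogonal matrices: fixed spaces, commutators, compactness *)

Section OrthogonalMatrices.
Variables (R : realType) (n : nat).
Implicit Types (u v w x y : 'cV[R]_n) (A B C D E K : 'M[R]_n) (e f : R).

Lemma dot_fixed_im E u w :
  E^T *m E = 1%:M -> E *m u = u -> dot u (E *m w - w) = 0.
Proof. by move=> EE Eu; rewrite dotBr -{1}Eu dot_mulmx // subrr. Qed.

Lemma fixed_im_eq0 E u w :
  E^T *m E = 1%:M -> E *m u = u -> u = E *m w - w -> u = 0.
Proof.
move=> EE Eu uE; apply/eqP; rewrite -dot_eq0 {2}uE; apply/eqP.
exact: dot_fixed_im.
Qed.

(** On [ker K], stable under [E], the image and the kernel of E - 1 are orthogonal, so they meet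
    trivially and fill [ker K] by rank-nullity. *)
Lemma fixed_im_decomp E K v : E^T *m E = 1%:M ->
  (forall x, K *m x = 0 -> K *m (E *m x) = 0) -> K *m v = 0 ->
  exists2 w, K *m w = 0 & E *m (v - (E *m w - w)) = v - (E *m w - w).
Proof.
(* Subspaces are row spaces: [V] holds the transposes of [ker K], and [N] acts on rows as E - 1 does
   on columns. *)
move=> EE KE Kv; pose V := kermx K^T; pose N := E^T - 1%:M.
have inV (x : 'rV_n) : (x <= V)%MS = (K *m x^T == 0).
  by rewrite sub_kermx -(inj_eq (@trmx_inj _ _ _)) trmx_mul trmxK trmx0.
have xN (x : 'rV_n) : x *m N = (E *m x^T - x^T)^T.
  by rewrite mulmxBr mulmx1 linearB /= trmx_mul trmxK.
have VN : (V *m N <= V)%MS.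
  apply/row_subP => i; rewrite row_mul xN inV trmxK mulmxBr.
  have /eqP Vi : K *m (row i V)^T == 0 by rewrite -inV row_sub.
  by rewrite KE Vi // subrr.
have cap0 : (V *m N :&: (V :&: kermx N) = 0)%MS.
  apply/eqP/rowV0P => x; rewrite sub_capmx => /andP[/submxP[y xy]].
  rewrite sub_capmx => /andP[_ /sub_kermxP]; rewrite xN => /(congr1 trmx).
  rewrite trmxK trmx0 => /subr0_eq Ex; apply: trmx_inj; rewrite trmx0.
  apply: (fixed_im_eq0 (w := (y *m V)^T) EE Ex).
  by rewrite {1}xy mulmxA xN trmxK.
have sumV : (V <= V *m N + (V :&: kermx N))%MS.
  have sumW : (V *m N + (V :&: kermx N) <= V)%MS by rewrite addsmx_sub VN capmxSl.
  rewrite -(geq_leqif (mxrank_leqif_sup sumW)).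
  by rewrite (mxrank_disjoint_sum cap0) mxrank_mul_ker.
have : (v^T <= V *m N + (V :&: kermx N))%MS.
  by apply: submx_trans sumV; rewrite inV trmxK Kv.
case/sub_addsmxP => -[y z] /= vE; exists (y *m V)^T.
  by apply/eqP; rewrite -inV submxMl.
have -> : v - (E *m (y *m V)^T - (y *m V)^T) = (z *m (V :&: kermx N)%MS)^T.
  rewrite -[E *m _ - _]trmxK -xN -mulmxA -[v in v - _]trmxK vE linearD /=.
  by rewrite addrC addKr.
apply/eqP; rewrite -subr_eq0 -(inj_eq (@trmx_inj _ _ _)) -xN trmx0; apply/eqP.
by apply/sub_kermxP/(submx_trans (submxMl _ _))/capmxSr.
Qed.

Lemma opdist_le_mulmxl C A B e : C^T *m C = 1%:M ->
  opdist_le A B e -> opdist_le (C *m A) (C *m B) e.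
Proof. by move=> CC AB x; rewrite -!mulmxA -mulmxBr enorm_mulmx. Qed.

Lemma opdist_le_mulmxr C A B e : C^T *m C = 1%:M ->
  opdist_le A B e -> opdist_le (A *m C) (B *m C) e.
Proof. by move=> CC AB x; rewrite -!mulmxA -(enorm_mulmx x CC). Qed.

Lemma opdist_le_entry A B e i j : opdist_le A B e -> `|A i j - B i j| <= e.
Proof.
move=> AB; have := AB (delta_mx j 0); rewrite -mulmxBl -colE.
rewrite [enorm (delta_mx _ _)](_ : _ = 1) ?mulr1 => [|].
  by apply: le_trans; have := ler_coord_enorm (col j (A - B)) i; rewrite !mxE.
rewrite /enorm dotE (bigD1 j) //= big1 ?addr0 => [|k /negPf kj].
  by rewrite !mxE !eqxx mulr1 sqrtr1.
by rewrite !mxE kj mul0r.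
Qed.

(* With a = |A - 1| and d = |D - 1|: DA - AD = (D - 1)(A - 1) - (A - 1)(D - 1). *)
Lemma opdist_le_commutator A D a d : A^T *m A = 1%:M -> D^T *m D = 1%:M ->
  0 <= a -> 0 <= d -> opdist_le A 1%:M a -> opdist_le D 1%:M d ->
  opdist_le (D^T *m A^T *m D *m A) 1%:M (2 * a * d).
Proof.
move=> AA DD a0 d0 A1 D1 x.
have -> : D^T *m A^T *m D *m A *m x - 1%:M *m x =
    D^T *m (A^T *m (D *m (A *m x) - A *m (D *m x))).
  rewrite !mulmxBr -!mulmxA; congr (_ - _).
  by rewrite (mulmxA A^T) AA !mul1mx mulmxA DD mul1mx.
have orthT (C : 'M[R]_n) : C^T *m C = 1%:M -> C^T^T *m C^T = 1%:M.
  by move=> CC; rewrite trmxK; apply: mulmx1C.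
rewrite !enorm_mulmx; [|exact: orthT..].
have -> : D *m (A *m x) - A *m (D *m x) =
    (D *m (A *m x - x) - (A *m x - x)) - (A *m (D *m x - x) - (D *m x - x)).
  by rewrite !mulmxBr !opprB !addrA; apply/colP=> i; rewrite !mxE; ring.
have A1' z : enorm (A *m z - z) <= a * enorm z by rewrite -{2}[z]mul1mx.
have D1' z : enorm (D *m z - z) <= d * enorm z by rewrite -{2}[z]mul1mx.
rewrite (le_trans (ler_enormB _ _)) //.
have h1 : enorm (D *m (A *m x - x) - (A *m x - x)) <= d * (a * enorm x).
  by rewrite (le_trans (D1' _)) // ler_wpM2l.
have h2 : enorm (A *m (D *m x - x) - (D *m x - x)) <= a * (d * enorm x).
  by rewrite (le_trans (A1' _)) // ler_wpM2l.
by rewrite (le_trans (lerD h1 h2)) // le_eqVlt; apply/orP; left; apply/eqP; ring.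
Qed.

Lemma pigeonhole_nat (F : finType) (f : nat -> F) :
  exists i j, (i < j)%N /\ f i = f j.
Proof.
apply: contrapT => noij.
have inj : injective (fun i : 'I_#|F|.+1 => f i).
  move=> i j fij; apply: val_inj; apply: contrapT => /eqP; rewrite neq_ltn.
  by case/orP=> ij; apply: noij; [exists i, j | exists j, i].
by have := leq_card _ inj; rewrite card_ord ltnn.
Qed.

(* The entries of an orthogonal matrix lie in [-1, 1]; two matrices of the
   sequence agree after rounding their entries to multiples of 1 / N. *)
Lemma orthogonal_pigeonhole (B : nat -> 'M[R]_n) e : 0 < e ->
  (forall k, (B k)^T *m B k = 1%:M) ->
  exists i j, (i < j)%N /\ opdist_le (B i) (B j) e.
Proof.
move=> e0 BB.
have Bent k i j : `|B k i j| <= 1.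
  have := ler_coord_enorm (col j (B k)) i; rewrite mxE => /le_trans; apply.
  rewrite colE enorm_mulmx // /enorm dotE (bigD1 j) //= big1 ?addr0.
    by rewrite !mxE !eqxx mulr1 sqrtr1.
  by move=> l /negPf lj; rewrite !mxE lj mul0r.
(* Entries within 1 / (N + 1) then give operator distance at most [e], despite the factor [n * n]
   lost in [opdist_le_of_entries]. *)
have [N Nlt] : exists N : nat, n%:R * n%:R / e < N.+1%:R.
  exists (Num.trunc (n%:R * n%:R / e)).
  by have /andP[] := trunc_itv (divr_ge0 (mulr_ge0 (ler0n R n) (ler0n R n)) (ltW e0)).
(* Shifted by 1, the entries are nonnegative, so truncation rounds down; it takes finitely many
   values. *)
pose r k i j := (B k i j + 1) * N.+1%:R.
have r_itv k i j : 0 <= r k i j <= (2 * N.+1)%:R.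
  have := Bent k i j; rewrite ler_norml => /andP[h1 h2].
  rewrite mulr_ge0 ?ler0n // -?lerBlDr ?sub0r //=.
  by rewrite natrM ler_wpM2r // ?ler0n // -lerBrDr; lra.
pose code k := [ffun ij : 'I_n * 'I_n =>
  inord (Num.trunc (r k ij.1 ij.2)) : 'I_(2 * N.+1).+1].
have [k [l [kl /ffunP ckl]]] := pigeonhole_nat code.
exists k, l; split=> //; apply: (@opdist_leW _ _ _ _ (N.+1%:R^-1 * n%:R * n%:R)).
  rewrite -mulrA ler_pdivrMl ?ltr0Sn // -ler_pdivrMr //; exact: ltW.
apply: opdist_le_of_entries => [|i j]; first by rewrite invr_ge0 ler0n.
have := ckl (i, j); rewrite !ffunE /= => /(congr1 val) /=.
have tr m : (Num.trunc (r m i j) < (2 * N.+1).+1)%N.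
  have /andP[r0 r1] := r_itv m i j; rewrite ltnS -(ler_nat R).
  by apply: le_trans r1; have /andP[] := trunc_itv r0.
rewrite !inordK // => tkl.
have /andP[rk0 _] := r_itv k i j; have /andP[rl0 _] := r_itv l i j.
have /andP[k1 k2] := trunc_itv rk0; have /andP[l1 l2] := trunc_itv rl0.
rewrite tkl in k1 k2; rewrite -[X in _ <= X]mul1r ler_pdivlMr ?ltr0Sn //.
rewrite -[X in _ * X]ger0_norm ?ler0n // -normrM ler_norml.
have -> : (B k i j - B l i j) * N.+1%:R = r k i j - r l i j by rewrite /r; ring.
by rewrite -natr1 in k2 l2; apply/andP; split; lra.
Qed.

End OrthogonalMatrices.

(** * Isometries and discreteness *)

Section IsometryTheory.
Variables (R : realType) (n : nat).
Implicit Types (g h d : isom R n) (u v w x y p : 'cV[R]_n) (e : R).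

Lemma linpart1 : linpart (1%g : isom R n) = 1%:M.
Proof. by []. Qed.

Lemma linpartM g h : linpart (g * h)%g = linpart g *m linpart h.
Proof. by []. Qed.

Lemma linpartV g : linpart (g^-1)%g = (linpart g)^T.
Proof. by []. Qed.

Lemma isom_act_mulg g h x : isom_act (g * h)%g x = isom_act g (isom_act h x).
Proof. exact: isom_actM. Qed.

Lemma isom_act_oneg x : isom_act 1%g x = x.
Proof. exact: isom_act1. Qed.

Lemma isom_actK g : cancel (isom_act g) (isom_act (g^-1)%g).
Proof. by move=> x; rewrite -isom_act_mulg mulVg isom_act_oneg. Qed.

Lemma isom_actVK g : cancel (isom_act (g^-1)%g) (isom_act g).
Proof. by move=> x; rewrite -isom_act_mulg mulgV isom_act_oneg. Qed.

Lemma isom_actD g x y : isom_act g (x + y) = isom_act g x + linpart g *m y.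
Proof. by rewrite /isom_act addrAC mulmxDr. Qed.

Definition is_trans g := linpart g = 1%:M.

Lemma is_trans_act g x : is_trans g -> isom_act g x = x + trpart g.
Proof. by rewrite /isom_act => ->; rewrite mul1mx. Qed.

Lemma is_transM g h : is_trans g -> is_trans h -> is_trans (g * h)%g.
Proof. by rewrite /is_trans linpartM => -> ->; rewrite mulmx1. Qed.

Lemma is_trans_eq g h : is_trans g -> is_trans h -> trpart g = trpart h -> g = h.
Proof. by rewrite /is_trans => tg th; apply: isom_eqP; rewrite tg th. Qed.

Lemma is_transX g k : is_trans g -> is_trans (g ^+ k)%g.
Proof. by move=> tg; elim: k => [//|k ih]; rewrite expgS; exact: is_transM. Qed.

Lemma trpart_transM g h :
  is_trans h -> trpart (g * h)%g = trpart h + trpart g.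
Proof. by rewrite /is_trans /trpart /= => ->; rewrite trmx1 mul1mx. Qed.

Lemma trpart_transX g k : is_trans g -> trpart (g ^+ k)%g = trpart g *+ k.
Proof.
move=> tg; elim: k => [//|k ih]; rewrite expgSr mulrS trpart_transM // ih.
by [].
Qed.

Lemma is_transC g h : is_trans g -> is_trans h -> (g * h = h * g)%g.
Proof.
move=> tg th; apply: is_trans_eq; [exact: is_transM..|].
by rewrite !trpart_transM // addrC.
Qed.

Lemma is_transJ g h : is_trans h -> is_trans (g * h * g^-1)%g.
Proof.
by rewrite /is_trans !linpartM linpartV => ->; rewrite mulmx1 linpartKT.
Qed.

(** Seen by letting the conjugate act on the origin. It lets linear parts be recovered from
    conjugation on translations. *)
Lemma trpart_transJ g h : is_trans h ->
  trpart (g * h * g^-1)%g = linpart g *m trpart h.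
Proof.
move=> th; have := is_trans_act 0 (is_transJ g th).
rewrite !isom_act_mulg (is_trans_act _ th) isom_actD isom_actVK.
by rewrite !add0r => ->.
Qed.

Lemma linpart_eq_trans g h : linpart g = linpart h -> is_trans (g^-1 * h)%g.
Proof. by rewrite /is_trans linpartM linpartV => <-; rewrite linpartTK. Qed.

Lemma geolength_trans g : is_trans g -> geolength g = enorm (trpart g).
Proof.
move=> tg; apply: (@geolengthE _ _ _ 0); first by rewrite is_trans_act.
by rewrite tg mul1mx.
Qed.

(** Turns the isolation of 1, stated in the topology induced from pairs, into a quantitative gap. *)
Lemma discrete_gap (Gamma : subgroup (isom R n)) : discrete_subgroup Gamma ->
  exists2 e, 0 < e & forall g, Gamma g ->
    opdist_le (linpart g) 1%:M e -> enorm (trpart g) <= e -> g = 1%g.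
Proof.
move=> /(_ 1%g (subgroup1 Gamma))[_ [U nU UG]].
have [W [[V oV <-] V1 VU]] : exists W : set (isom R n),
    [/\ open W, W 1%g & W `<=` U].
  by move: nU; rewrite nbhsE => -[W [oW W1] WU]; exists W.
have /nbhs_ballP[e e0 eV] : nbhs (1%:M : 'M[R]_n, 0 : 'cV[R]_n) V.
  exact: open_nbhs_nbhs.
exists (e / 2); rewrite ?divr_gt0 // => g Gg g1 gt.
have e2 : e / 2 < e by rewrite ltr_pdivrMr // mulr2n mulrDr mulr1 ltrDl.
suff : (U `&` Gamma) g by rewrite UG.
split=> //; apply/VU/eV; split => /=.
  split=> // i j; rewrite -ball_normE /= distrC (le_lt_trans _ e2) //.
  exact: opdist_le_entry.
split=> // i j; rewrite -ball_normE /= mxE sub0r normrN (le_lt_trans _ e2) //.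
by rewrite ord1 (le_trans (ler_coord_enorm _ _)).
Qed.

End IsometryTheory.

(** * Derivatives of affine maps *)

Section MulmxCalculus.
Variables (R : realType) (m n : nat) (M : 'M[R]_(m, n)).

Lemma mulmx_continuous : continuous (mulmx M : 'cV[R]_n -> 'cV[R]_m).
Proof.
have -> : (mulmx M : 'cV[R]_n -> 'cV[R]_m) =
    \sum_(i < n) (fun x : 'cV[R]_n => x i 0 *: col i M).
  apply/funext => x; rewrite fct_sumE; apply/colP => j; rewrite mxE summxE.
  by apply: eq_bigr => i _; rewrite !mxE mulrC.
move=> x; apply: differentiable_continuous; apply: differentiable_sum => i.
apply: (@differentiable_comp _ _ _ _ (fun x : 'cV[R]_n => x i 0)
  (fun k : R => k *: col i M)) => //.
exact: differentiable_coord.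
Qed.

Lemma differentiable_affine c x : differentiable (fun x : 'cV[R]_n => M *m x + c) x.
Proof.
apply: differentiableD => //; apply/linear_differentiable/mulmx_continuous.
Qed.

Lemma diff_affine c x v :
  'd (fun x : 'cV[R]_n => M *m x + c) x v = M *m v.
Proof.
have dM : differentiable (mulmx M : 'cV[R]_n -> 'cV[R]_m) x.
  exact/linear_differentiable/mulmx_continuous.
have dL : 'd (mulmx M : 'cV[R]_n -> 'cV[R]_m) x v = M *m v.
  by rewrite diff_lin //; apply: mulmx_continuous.
have dc := congr1 (@^~ v) (diff_cst (V := 'cV[R]_n) c x).
have dD := congr1 (@^~ v) (diffD dM (differentiable_cst c x)).
have fE : (fun y : 'cV[R]_n => M *m y + c) = (mulmx M : 'cV[R]_n -> 'cV[R]_m) + cst c.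
  by apply/funext => y.
rewrite fE.
apply: (etrans dD).
apply: (etrans (congr1 (fun t => t + 'd (cst c) x v) dL)).
apply: (etrans (congr1 (fun t => M *m v + t) dc)).
exact: addr0.
Qed.
End MulmxCalculus.

(** Directional derivatives of an affine map are constant, hence affine with matrix 0; so the
    induction generalizes [M] and [c]. *)
Lemma affine_class_C (R : realType) (m n : nat) (M : 'M[R]_(m, n)) c k U :
  class_C k U (fun x => M *m x + c).
Proof.
elim: k M c => [|k ih] M c /=.
  move=> x _; exact/differentiable_continuous/differentiable_affine.
split=> [x _|v]; first exact: differentiable_affine.
have -> : (fun x => 'd (fun x => M *m x + c) x v) = (fun x => 0 *m x + M *m v).
  by apply/funext => x; rewrite diff_affine mul0mx add0r.
exact: ih.
Qed.

(** * Orbits of a cocompact action *)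

Section Cocompact.
Variables (R : realType) (n : nat) (Gamma : subgroup (isom R n)).
Implicit Types (g h d : isom R n) (u v w x y p : 'cV[R]_n) (e : R).

Lemma isom_act_continuous g : continuous (isom_act g).
Proof.
have -> : isom_act g = (fun x => linpart g *m x + linpart g *m trpart g).
  by apply/funext => x; rewrite /isom_act mulmxDr.
by move=> x; apply/differentiable_continuous/differentiable_affine.
Qed.

Lemma ler_coord_norm y i : `|y i 0| <= `|y|.
Proof.
rewrite [leRHS]/Num.Def.normr /= mx_normrE; apply/bigmax_geP; right => /=.
by exists (i, 0).
Qed.

Lemma flat_projP x y :
  reflect (exists2 g, Gamma g & isom_act g x = y)
          (flat_proj Gamma x == flat_proj Gamma y).
Proof.
rewrite /flat_proj; apply: (iffP idP) => [|h].
  by move=> /eqP/eqquotP/asboolP.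
by apply/eqP/eqquotP/asboolP.
Qed.

(** The images of the balls of radius [k * n] grow with [k] and cover the quotient locally, so by
    compactness one [k] suffices. If [g] sends a point y of that ball to [x], then |g p - x| = |p -
    y|. *)
Lemma cocompact_orbit_near : cocompact Gamma ->
  exists2 K, 0 <= K & forall p x,
    exists2 g, Gamma g & enorm (isom_act g p - x) <= K + enorm p.
Proof.
move=> /compact_near_coveringP.
pose P (k : nat) (q : flat_manifold Gamma) :=
  exists2 y, enorm y <= k%:R * n%:R & flat_proj Gamma y = q.
move=> /(_ _ \oo P _)[].
  move=> q _; pose x : 'cV[R]_n := repr q.
  pose U := flat_proj Gamma @` ball x 1.
  have oU : open U.
    rewrite /open /= /quotient_open.
    (* The preimage of [U] is the union of the translates of the ball, hence open. *)
    rewrite (_ : _ @^-1` _ = \bigcup_(g in Gamma) (isom_act g @^-1` ball x 1)).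
      apply: bigcup_open => g _; apply: open_comp; last exact: ball_open.
      by move=> y _; exact: isom_act_continuous.
    apply/seteqP; split=> [y /= [z xz /eqP/flat_projP[g Gg gz]]|y [g Gg /= gy]].
      exists (g^-1)%g; first exact: subgroupV.
      by rewrite /= -gz isom_actK.
    exists (isom_act g y) => //; apply/eqP; rewrite eq_sym.
    by apply/flat_projP; exists g.
  have Uq : U q by exists x; [exact: ballxx|exact: reprK].
  have [N xN] : exists N : nat, `|x| + 1 < N%:R.
    exists (Num.trunc (`|x| + 1)).+1.
    by have /andP[] := trunc_itv (addr_ge0 (normr_ge0 x) ler01).
  exists (U, [set k | (N <= k)%N]).
    split=> /=; last exact: nbhs_infty_ge.
    by apply: (@open_nbhs_nbhs (flat_manifold Gamma)); split.
  move=> [_ k] /= [[y xy <-] Nk]; exists y => //.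
  apply: (le_trans (enorm_le_sum _)).
  rewrite mulr_natr -[X in _ <= _ *+ X]card_ord -sumr_const.
  apply: ler_sum => i _; apply: (@le_trans _ _ N%:R); last by rewrite ler_nat.
  apply: (le_trans _ (ltW xN)); apply: (@le_trans _ _ `|y|).
    exact: ler_coord_norm.
  rewrite -[y](subrK x) addrC (le_trans (ler_normD _ _)) // lerD2l.
  by apply: ltW; rewrite distrC; move: xy; rewrite -ball_normE.
move=> N _ /(_ N (leqnn N)) NP.
exists (N%:R * n%:R) => [|p x]; first by rewrite mulr_ge0 ?ler0n.
have [y yN /eqP/flat_projP[g Gg gy]] := NP (flat_proj Gamma x) I.
exists g => //; have -> : isom_act g p - x = linpart g *m (p - y).
  by rewrite -gy -{1}(subrKC y p) isom_actD addrAC subrr add0r.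
rewrite enorm_mulmx ?linpartTK // (le_trans (ler_enormB _ _)) //.
by rewrite addrC lerD2r.
Qed.
End Cocompact.

(** * Bieberbach's first theorem *)

Section SmallRotations.
Variables (R : realType) (n : nat) (Gamma : subgroup (isom R n)).
Implicit Types (al g h d : isom R n) (u v w x y p : 'cV[R]_n) (e : R).

Lemma enorm_isom_act g x y : enorm (isom_act g x - isom_act g y) = enorm (x - y).
Proof.
by rewrite -{1}(subrKC y x) isom_actD addrAC subrr add0r enorm_mulmx ?linpartTK.
Qed.

(** Let [g k] move [p] to within [K] of p + k M u. Two of them, i < j, have [e]-close linear parts;
    d = g_j g_i^-1 then displaces [p] with [u]-component at least (j - i) M |u|^2 - 2 K |u|. *)
Lemma orbit_direction p u e : cocompact Gamma -> u != 0 -> 0 < e ->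
  exists2 d, Gamma d & opdist_le (linpart d) 1%:M e /\
    0 < dot (isom_act d p - p) u.
Proof.
move=> /cocompact_orbit_near[K0 K00 K0P] u0 e0.
set K := K0 + enorm p; have {}K0P x := K0P p x; rewrite -/K in K0P.
(* M |u| = 2 K + 1 just beats the accumulated error 2 K. *)
have u_gt0 := enorm_gt0 u0; pose M := (2 * K + 1) / enorm u.
have Mu : M * enorm u = 2 * K + 1 by rewrite divfK // gt_eqF.
have K_ge0 : 0 <= K by rewrite addr_ge0 ?enorm_ge0.
have M_ge0 : 0 <= M by rewrite divr_ge0 ?enorm_ge0 //; lra.
have [g gP] := choice (fun k : nat =>
  let: ex_intro2 g Gg gk := K0P (p + (k%:R * M) *: u) in
  ex_intro (fun g => Gamma g /\ _ <= K) g (conj Gg gk)).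
have [i [j [ij Bij]]] :=
  orthogonal_pigeonhole e0 (fun k => linpartTK (g k)).
have Gd : Gamma (g j * (g i)^-1)%g.
  by apply: subgroupM; [case: (gP j) | apply: subgroupV; case: (gP i)].
exists (g j * (g i)^-1)%g => //; split.
  rewrite linpartM linpartV -(linpartKT (g i)).
  apply: opdist_le_mulmxr; first by rewrite trmxK linpartKT.
  by move=> x; rewrite enormBC.
set d := (g j * _)%g.
have dE : isom_act d p - p =
    (isom_act (g j) p - p) - linpart d *m (isom_act (g i) p - p).
  have -> : isom_act (g j) p = isom_act d (isom_act (g i) p).
    by rewrite isom_act_mulg isom_actK.
  rewrite -{1}(subrKC p (isom_act (g i) p)) isom_actD.
  by apply/colP => k; rewrite !mxE; ring.
pose r k := isom_act (g k) p - p - (k%:R * M) *: u.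
have rK k : enorm (r k) <= K.
  by rewrite /r -addrA -opprD; case: (gP k).
have actr k : isom_act (g k) p - p = (k%:R * M) *: u + r k.
  by rewrite /r subrKC.
have h1 : j%:R * M * dot u u - K * enorm u <= dot (isom_act (g j) p - p) u.
  rewrite actr dotDl dotZl lerD2l.
  have := cauchy_schwarz (r j) u; rewrite ler_norml => /andP[+ _].
  by apply: le_trans; rewrite lerN2 ler_wpM2r ?enorm_ge0.
have h2 : dot (linpart d *m (isom_act (g i) p - p)) u <=
    (i%:R * M * enorm u + K) * enorm u.
  rewrite (le_trans (ler_norm _)) // (le_trans (cauchy_schwarz _ _)) //.
  rewrite ler_wpM2r ?enorm_ge0 // enorm_mulmx ?linpartTK // actr.
  rewrite (le_trans (ler_enormD _ _)) // lerD ?rK //.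
  rewrite /enorm dotZl dotZr mulrA -expr2 sqrtrM ?sqr_ge0 // sqrtr_sqr ger0_norm //.
  by rewrite mulr_ge0 ?ler0n.
rewrite dE dotBl; rewrite -enorm_sqr in h1.
have ijM : i%:R * M + M <= j%:R * M.
  by rewrite -[X in _ + X]mul1r -mulrDl ler_wpM2r // natr1 ler_nat.
have h3 : (i%:R * M + M) * enorm u ^+ 2 <= j%:R * M * enorm u ^+ 2.
  by rewrite ler_wpM2r // sqr_ge0.
have h4 : M * enorm u ^+ 2 = (2 * K + 1) * enorm u by rewrite -Mu; ring.
lra.
Qed.

(* [g] maps the affine subspace [p + ker (linpart al - 1)] into itself. *)
Definition preserves_axis al p g :=
  (forall v, linpart al *m v = v ->
     linpart al *m (linpart g *m v) = linpart g *m v) /\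
  linpart al *m (isom_act g p - p) = isom_act g p - p.

Lemma linpart_fixV g v : linpart g *m v = v -> (linpart g)^T *m v = v.
Proof. by move=> gv; rewrite -{1}gv mulmxA linpartTK mul1mx. Qed.

Lemma linpart_fixVK g v : (linpart g)^T *m v = v -> linpart g *m v = v.
Proof. by move=> gv; rewrite -{1}gv mulmxA linpartKT mul1mx. Qed.

(* A vector v2 of V = ker (A - 1) orthogonal to D^-1 V would be orthogonal to
   D v2, which is too close to v2; hence D V = V. *)
Lemma preserves_axis_commutator al p d :
  linpart al *m (isom_act al p - p) = isom_act al p - p ->
  opdist_le (linpart d) 1%:M 1 ->
  preserves_axis al p [~ d, al]%g -> preserves_axis al p d.
Proof.
set A := linpart al; set a := _ - p; set D := linpart d => Aa D1 [kV kp].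
have AA : A^T *m A = 1%:M by exact: linpartTK.
have DD : D^T *m D = 1%:M by exact: linpartTK.
(* [eta] is conjugate to the inverse of [al], but also a product of two maps preserving the axis; so
   [E] preserves V = ker (A - 1) and [eta] moves [p] along V. *)
pose eta := (d^-1 * al^-1 * d)%g; pose E := linpart eta.
have etaE : eta = ([~ d, al] * al^-1)%g by rewrite commgEl !mulgA mulgK.
have EE : E^T *m E = 1%:M by exact: linpartTK.
have EV v : A *m v = v -> A *m (E *m v) = E *m v.
  move=> Av; rewrite /E etaE linpartM linpartV -mulmxA.
  by rewrite (linpart_fixV Av); exact: kV.
have aVp : isom_act al^-1%g p = p - a.
  apply: (canLR (isom_actK al)); rewrite isom_actD mulmxN -/A Aa /a.
  by rewrite opprB subrKC.
have Aep : A *m (isom_act eta p - p) = isom_act eta p - p.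
  rewrite etaE isom_act_mulg aVp isom_actD mulmxN addrAC mulmxDr kp mulmxN.
  by rewrite kV.
have fixA x : (A - 1%:M) *m x = 0 <-> A *m x = x.
  rewrite mulmxBl mul1mx; split=> [/subr0_eq //|->]; exact: subrr.
have DV v : A *m v = v -> A *m (D *m v) = D *m v.
  (* Split [v] inside V into a part fixed by [E] and [v2]. Since E = D^-1 A^-1 D fixes D^-1 V
     pointwise, [v2] is orthogonal to D^-1 V. Once [v2] vanishes, E v = v says that A fixes D v. *)
  move=> Av; have [w] : exists2 w, (A - 1%:M) *m w = 0 &
      E *m (v - (E *m w - w)) = v - (E *m w - w).
    apply: fixed_im_decomp => //; last exact/fixA.
    by move=> x /fixA Ax; apply/fixA/EV.
  move=> /fixA Aw; set v2 := E *m w - w => Ev.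
  have Av2 : A *m v2 = v2 by rewrite mulmxBr EV ?Aw.
  have ED : E *m (D^T *m v2) = D^T *m v2.
    rewrite /E !linpartM !linpartV -/A -/D -!mulmxA (mulmxA D) linpartKT mul1mx.
    by rewrite (linpart_fixV Av2).
  have v2D : dot v2 (D *m v2) = 0.
    by rewrite -[D]trmxK -dot_mulmxl; exact: dot_fixed_im.
  have distD z :
      dot (D *m z - z) (D *m z - z) = dot z z *+ 2 - dot z (D *m z) *+ 2.
    by rewrite dotBl !dotBr dot_mulmx // (dotC (D *m z) z); ring.
  have v20 : v2 = 0.
    apply/eqP; rewrite -dot_eq0 eq_le dot_ge0 andbT.
    have := D1 v2; rewrite mul1mx mul1r -ler_sqr ?nnegrE ?enorm_ge0 //.
    by rewrite !enorm_sqr distD v2D; lra.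
  rewrite v20 subr0 in Ev; apply: linpart_fixVK.
  have /(congr1 (mulmx D)) := Ev; rewrite /E !linpartM !linpartV -!mulmxA.
  by rewrite mulmxA linpartKT mul1mx.
split=> //; set t := _ - p; apply: linpart_fixVK; rewrite -/A.
(* This is d eta = al^-1 d evaluated at [p]. Its right side lies in V, so A^-1 t - t is both fixed
   by A^-1 and in the image of A^-1 - 1, hence zero. *)
have key : A^T *m t - t = D *m (isom_act eta p - p) + a.
  have : isom_act d (isom_act eta p) = isom_act al^-1%g (isom_act d p).
    by rewrite -!isom_act_mulg /eta !mulgA mulgV mul1g.
  rewrite -{1}(subrKC p (isom_act eta p)) -[X in isom_act al^-1%g X](subrKC p).
  rewrite !isom_actD aVp linpartV.
  rewrite -/A -/D -/t => /(congr1 (fun x => x - p - t + a)).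
  have -> : p - a + A^T *m t - p - t + a = A^T *m t - t.
    by apply/colP => i; rewrite !mxE; ring.
  by move=> <-; rewrite /t; apply/colP => i; rewrite !mxE; ring.
have fA : A^T *m (A^T *m t - t) = A^T *m t - t.
  by apply: linpart_fixV; rewrite -/A key mulmxDr Aa DV.
apply/subr0_eq/(fixed_im_eq0 (E := A^T) _ fA erefl).
by rewrite trmxK linpartKT.
Qed.

Lemma preserves_axis1 al p : preserves_axis al p 1%g.
Proof.
split=> [v|]; first by rewrite linpart1 mul1mx.
by rewrite isom_act_oneg subrr mulmx0.
Qed.

(** [discrete_gap] asks for a small translation part, while the commutator estimates control the
    displacement of [p]. *)
Lemma enorm_trpart_le p g :
  enorm (trpart g) <=
  enorm (isom_act g p - p) + enorm (linpart g *m p - 1%:M *m p).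
Proof.
have -> : trpart g = (linpart g)^T *m (isom_act g p - linpart g *m p).
  by rewrite /isom_act -mulmxBr addrAC subrr add0r mulmxA linpartTK mul1mx.
rewrite enorm_mulmx ?trmxK ?linpartKT // mul1mx.
by rewrite -(subrKA p) -(opprB _ p) ler_enormB.
Qed.

(** Moving the base point from 0 to [- w] removes from the displacement its component in the image
    of A - 1. *)
Lemma exists_axis al :
  exists p, linpart al *m (isom_act al p - p) = isom_act al p - p.
Proof.
have [|||w _ h] := @fixed_im_decomp _ _ (linpart al) 0 (isom_act al 0).
- exact: linpartTK.
- by move=> x _; rewrite mul0mx.
- exact: mul0mx.
exists (- w); suff -> : isom_act al (- w) - - w =
  isom_act al 0 - (linpart al *m w - w) by [].
by rewrite -[X in isom_act _ X - _]add0r isom_actD mulmxN opprK opprB addrAC addrA.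
Qed.

(* Iterated commutators [~ ... [~ d, al], ..., al] tend to 1, hence reach it. *)
Lemma small_rotation_preserves_axis al p d : discrete_subgroup Gamma ->
  Gamma al -> Gamma d ->
  linpart al *m (isom_act al p - p) = isom_act al p - p ->
  opdist_le (linpart al) 1%:M 4^-1 -> opdist_le (linpart d) 1%:M 1 ->
  preserves_axis al p d.
Proof.
move=> dG Gal Gd alp al1 d1; set a := isom_act al p - p in alp.
pose c k := iter k (fun g => [~ g, al]%g) d.
(* The term [4 * enorm a] gives |a| <= K / 4, so each commutator halves the displacement bound: 2^-k
   |a| + 2^-k K / 4 <= 2^-(k+1) K. *)
pose K := enorm (isom_act d p - p) + 4 * enorm a.
have K0 : 0 <= K by rewrite addr_ge0 ?mulr_ge0 ?enorm_ge0.
have aK : enorm a <= K / 4.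
  by rewrite ler_pdivlMr // mulrC lerDr enorm_ge0.
have Gc k : Gamma (c k).
  elim: k => // k ih; rewrite /= commgEl.
  by do !apply: subgroupM => //; exact: subgroupV.
have cP k : opdist_le (linpart (c k)) 1%:M (2^-1 ^+ k) /\
    enorm (isom_act (c k) p - p) <= 2^-1 ^+ k * K.
  have two0 m : 0 <= 2^-1 ^+ m :> R by rewrite exprn_ge0 // invr_ge0.
  elim: k => [|k [ih1 ih2]]; rewrite ?expr0 ?mul1r.
    by split=> //; rewrite lerDl mulr_ge0 ?enorm_ge0.
  have -> : c k.+1 = ((c k)^-1 * al^-1 * c k * al)%g.
    by rewrite /= commgEl !mulgA.
  move: (c k) ih1 ih2 => g ih1 ih2; split.
    rewrite !linpartM !linpartV.
    apply: (opdist_leW _ (opdist_le_commutator _ _ _ _ al1 ih1)) => //;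
      try exact: linpartTK.
    - by rewrite exprS ler_wpM2r //; lra.
  (* Applying [al * g] turns the displacement of the commutator at [p] into the distance from g (al
     p) to al (g p). *)
  rewrite -(enorm_isom_act (al * g)%g) -!isom_act_mulg !mulgA mulgK mulgV mul1g.
  rewrite !isom_act_mulg -[isom_act al p](subrKC p) -/a.
  rewrite -[X in isom_act al X](subrKC p) !isom_actD -/a.
  set t := _ - p in ih2 *.
  have -> : isom_act g p + linpart g *m a - (isom_act al p + linpart al *m t) =
      (linpart g *m a - 1%:M *m a) - (linpart al *m t - 1%:M *m t).
    by rewrite !mul1mx; apply/colP => i; rewrite !mxE; ring.
  rewrite (le_trans (ler_enormB _ _)) // exprS.
  have h1 := ih1 a; have h2 := al1 t; have := two0 k.
  move: (2^-1 ^+ k) h1 ih2 => s h1 ih2 s0.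
  have : s * enorm a <= s * (K / 4) by rewrite ler_wpM2l.
  nra.
have [e e0 eP] := discrete_gap dG.
have [k ck] : exists k, c k = 1%g.
  (* The summand 1 serves the bound on the linear part, and K + |p| the one on the translation
     part. *)
  pose k := (Num.trunc ((1 + K + enorm p) / e)).+1.
  have Kp0 : 0 <= 1 + K + enorm p by rewrite addr_ge0 ?enorm_ge0 // addr_ge0.
  have kP : 2^-1 ^+ k * (1 + K + enorm p) <= e.
    rewrite exprVn ler_pdivrMl ?exprn_gt0 // -ler_pdivrMr //.
    have /andP[_ /ltW] := trunc_itv (divr_ge0 Kp0 (ltW e0)).
    by move=> /le_trans; apply; rewrite -natrX ler_nat ltnW // ltn_expl.
  have [h1 h2] := cP k; exists k; apply: eP => //.
    apply: opdist_leW h1; apply: le_trans kP.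
    rewrite ler_peMr ?exprn_ge0 ?invr_ge0 //.
    by rewrite -addrA lerDl addr_ge0 ?enorm_ge0.
  apply: le_trans kP; apply: (le_trans (enorm_trpart_le p _)).
  have := h1 p; have : 0 <= 2^-1 ^+ k :> R by rewrite exprn_ge0 ?invr_ge0.
  move: (2^-1 ^+ k) h2 => s; nra.
(* Descend from [c k = 1], each [c i.+1] being the commutator of [c i] with [al]. *)
have : forall j, (j <= k)%N -> preserves_axis al p (c (k - j)%N).
  elim=> [_|j ih jk]; first by rewrite subn0 ck; exact: preserves_axis1.
  apply: preserves_axis_commutator => //.
    apply: opdist_leW (proj1 (cP _)).
    by rewrite exprn_ile1 ?invr_ge0 // invf_le1 ?ler1n.
  rewrite -[[~ _, _]%g]/(c (k - j.+1).+1) -subSn // subSS.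
  by apply: ih; exact: ltnW.
by move=> /(_ k (leqnn k)); rewrite subnn.
Qed.

(* Otherwise the orbit of an axis point could not leave the axis orthogonally,
   against cocompactness. *)
Lemma small_rotation_trans al : discrete_subgroup Gamma -> cocompact Gamma ->
  Gamma al -> opdist_le (linpart al) 1%:M 4^-1 -> is_trans al.
Proof.
move=> dG cG Gal al1; have [p alp] := exists_axis al.
have fix_all x : linpart al *m x = x.
  apply: contrapT => /eqP; rewrite -subr_eq0 => u0.
  have [d Gd [d1]] := orbit_direction p cG u0 ltr01.
  have [_ dp] := small_rotation_preserves_axis dG Gal Gd alp al1 d1.
  by rewrite dot_fixed_im ?ltxx ?linpartTK.
apply/matrixP => i j; have := fix_all (delta_mx j 0).
by rewrite -colE => /colP/(_ i); rewrite !mxE eqxx andbT.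
Qed.

End SmallRotations.

Lemma subgroupX (G : groupType) (S : subgroup G) (g : G) k :
  S g -> S (g ^+ k)%g.
Proof.
move=> Sg; elim: k => [|k ih]; first exact: subgroup1.
by rewrite expgS; exact: subgroupM.
Qed.

(** * The translations of [Gamma] and its point group *)

Section TranslationLattice.
Variables (R : realType) (n : nat) (Gamma : subgroup (isom R n)).
Hypotheses (dG : discrete_subgroup Gamma) (cG : cocompact Gamma).
Implicit Types (g h d : isom R n) (u v w x y p : 'cV[R]_n) (e : R).

Let quarter_gt0 : 0 < 4^-1 :> R. Proof. by rewrite invr_gt0. Qed.

Lemma trans_exists_dot u : u != 0 ->
  exists2 g, Gamma g & is_trans g /\ 0 < dot (trpart g) u.
Proof.
move=> u0; have [d Gd [d1]] := orbit_direction 0 cG u0 quarter_gt0.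
have td := small_rotation_trans dG cG Gd d1.
by rewrite is_trans_act // add0r subr0 => du; exists d.
Qed.

(** A nonzero row of [M] would pair positively with a translation vector. This form of spanning
    proves matrix identities by testing them on translations. *)
Lemma trans_span_mx m (M : 'M[R]_(m, n)) :
  (forall g, Gamma g -> is_trans g -> M *m trpart g = 0) -> M = 0.
Proof.
move=> M0; apply/row_matrixP => i; rewrite row0; apply: trmx_inj; rewrite trmx0.
apply: contrapT => /eqP /trans_exists_dot[g Gg [tg]].
by rewrite dotC /dot trmxK -row_mul M0 // row0 mxE ltxx.
Qed.

(** By compactness two powers of [g] have close linear parts; their quotient is a small rotation. *)
Lemma power_trans g : Gamma g -> exists2 k, (0 < k)%N & is_trans (g ^+ k)%g.
Proof.
move=> Gg; have [i [j [ij]]] := orthogonal_pigeonhole quarter_gt0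
  (fun k => linpartTK (g ^+ k)%g).
rewrite -(subnKC (ltnW ij)) expgnDr linpartM => Bij.
exists (j - i)%N; first by rewrite subn_gt0.
apply: small_rotation_trans dG cG (subgroupX _ Gg) _ => x.
have := opdist_le_mulmxl (C := (linpart (g ^+ i)%g)^T) _ Bij.
rewrite mulmxA linpartTK mul1mx trmxK linpartKT => /(_ erefl x).
by rewrite enormBC.
Qed.

(** A purely group-theoretic criterion. Forward: some power of [h] is a translation. Backward: for
    [h] a translation by t, commuting with [h ^+ k] gives A (k t) = k t, and such t span. *)
Lemma is_trans_centralP g : Gamma g ->
  is_trans g <-> forall h, Gamma h ->
    exists2 k, (0 < k)%N & (g * h ^+ k = h ^+ k * g)%g.
Proof.
move=> Gg; split=> [tg h /power_trans[k k0 tk]|gC].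
  by exists k => //; exact: is_transC.
apply/subr0_eq/trans_span_mx => h Gh th.
have [k k0 ghk] := gC h Gh.
have := trpart_transJ g (is_transX k th); rewrite ghk mulgK trpart_transX //.
rewrite -scaler_nat -scalemxAr => /eqP.
rewrite -subr_eq0 -scalerBr scaler_eq0 pnatr_eq0 eqn0Ngt k0 /= subr_eq0.
by rewrite mulmxBl mul1mx => /eqP <-; exact: subrr.
Qed.

(** Otherwise two distinct linear parts would lie within 1/4 of each other; elements carrying them
    would differ by a translation. *)
Lemma finite_point_group : finite_set [set linpart g | g in Gamma].
Proof.
apply: contrapT => /infiniteP /pcard_leP[f].
have fG k : exists g, Gamma g /\ linpart g = f k.
  by have [g Gg gf] := @funS _ _ _ _ f k I; exists g.
have [g gP] := choice fG.
have [i [j [ij]]] := orthogonal_pigeonhole quarter_gt0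
  (fun k => linpartTK (g k)).
move=> /(opdist_le_mulmxl (C := (linpart (g j))^T)).
rewrite trmxK linpartKT linpartTK => /(_ erefl) gij.
have : is_trans ((g j)^-1 * g i)%g.
  apply: (small_rotation_trans dG cG); last by rewrite linpartM linpartV.
  by apply: subgroupM; [apply: subgroupV; case: (gP j) | case: (gP i)].
rewrite /is_trans linpartM linpartV => /(congr1 (mulmx (linpart (g j)))).
rewrite mulmxA linpartKT mul1mx mulmx1.
have [_ ->] := gP i; have [_ ->] := gP j => fij.
have : i = j by apply: (@inj _ _ setT f) => //; rewrite ?inE.
by move=> eij; rewrite eij ltnn in ij.
Qed.

(** Greedy choice: take [u] orthogonal to the first [k] vectors, then a translation pairing
    positively with [u]. *)
Lemma trans_basis_step k : (k <= n)%N ->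
  exists g : nat -> isom R n, (forall i, Gamma (g i) /\ is_trans (g i)) /\
    row_free (\matrix_(i < k) (trpart (g i))^T).
Proof.
elim: k => [_|k ih kn].
  exists (fun=> 1%g); split; first by split; [exact: subgroup1|].
  by rewrite /row_free -leqn0 rank_leq_row.
have [g [gP gfree]] := ih (ltnW kn); set P := \matrix_i _ in gfree.
have [u u0 Pu] : exists2 u : 'cV[R]_n, u != 0 & P *m u = 0.
  have : kermx P^T != 0.
    rewrite -mxrank_eq0 mxrank_ker mxrank_tr (eqP gfree) subn_eq0 -ltnNge //.
  case/rowV0Pn => y /sub_kermxP yP y0; exists y^T; last first.
    by apply: trmx_inj; rewrite trmx_mul trmxK trmx0.
  by rewrite -(inj_eq (@trmx_inj _ _ _)) trmxK trmx0.
have [h Gh [th hu]] := trans_exists_dot u0.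
exists (fun i => if i == k then h else g i); split=> [i|]; first by case: eqP.
apply: inj_row_free => y; rewrite mulmx_sum_row big_ord_recr /=.
rewrite rowK eqxx; under eq_bigr => i _ do
  rewrite rowK /= (ltn_eqF (ltn_ord i)) -[(trpart _)^T](rowK (fun i => (trpart (g i))^T)).
have -> : \sum_(i < k) y 0 (widen_ord (leqnSn k) i) *: row i P =
    (\row_i y 0 (widen_ord (leqnSn k) i)) *m P.
  by rewrite mulmx_sum_row; apply: eq_bigr => i _; rewrite mxE.
(* Pairing the relation with [u] isolates the last coefficient. *)
move=> yP; have ymax : y 0 ord_max = 0.
  have := congr1 (fun z : 'rV[R]_n => (z *m u) 0 0) yP.
  rewrite mulmxDl -mulmxA Pu mulmx0 add0r -scalemxAl mul0mx [RHS]mxE mxE.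
  by move/eqP; rewrite mulf_eq0 => /orP[/eqP //|]; rewrite (gt_eqF hu).
move: yP; rewrite ymax scale0r addr0 -(mul0mx _ P).
move=> /(row_free_inj gfree)/rowP y0; apply/rowP => i; rewrite mxE.
have [ik|] := ltnP i k.
  have := y0 (Ordinal ik); rewrite !mxE => <-; congr (y 0 _); exact: val_inj.
move=> ki; rewrite -ymax; congr (y 0 _); apply: val_inj => /=.
by apply/eqP; rewrite eqn_leq ki -ltnS ltn_ord.
Qed.

Lemma trans_basis :
  exists g : nat -> isom R n, (forall i, Gamma (g i) /\ is_trans (g i)) /\
    (\matrix_(i < n) (trpart (g i))^T) \in unitmx.
Proof.
have [g [gP gfree]] := trans_basis_step (leqnn n).
by exists g; rewrite -row_free_unit.
Qed.

End TranslationLattice.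

(** * Rigidity *)

Section SubgroupIsomorphism.
Variables (G H : groupType) (S : subgroup G) (phi : G -> H).
Hypothesis phiM : forall g h, S g -> S h -> phi (g * h)%g = (phi g * phi h)%g.

Lemma subgroup_morph1 : phi 1%g = 1%g.
Proof.
have := phiM (subgroup1 S) (subgroup1 S); rewrite mulg1.
by move=> /(congr1 (fun x => (phi 1)^-1 * x)%g); rewrite mulgA mulVg mul1g => <-.
Qed.

Lemma subgroup_morphX g k : S g -> phi (g ^+ k)%g = (phi g ^+ k)%g.
Proof.
move=> Sg; elim: k => [|k ih]; first exact: subgroup_morph1.
by rewrite !expgS phiM ?ih //; exact: subgroupX.
Qed.

Lemma subgroup_morphJ g h : S g -> S h -> phi (g * h * g^-1)%g = (phi g * phi h * (phi g)^-1)%g.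
Proof.
move=> Sg Sh; have SV := subgroupV Sg; have Sgh := subgroupM Sg Sh.
suff gJ : (phi (g * h * g^-1) * phi g = phi g * phi h)%g by rewrite -gJ mulgK.
by rewrite -!phiM ?mulgVK //; exact: subgroupM.
Qed.

End SubgroupIsomorphism.

Section Rigidity.
Variables (R : realType) (n n' : nat).
Variables (Gamma : subgroup (isom R n)) (Gamma' : subgroup (isom R n')).
Hypotheses (dG : discrete_subgroup Gamma) (cG : cocompact Gamma).
Hypotheses (dG' : discrete_subgroup Gamma') (cG' : cocompact Gamma').
Variable phi : isom R n -> isom R n'.
Hypothesis phi_bij : set_bij Gamma Gamma' phi.
Hypothesis phiM :
  forall g h, Gamma g -> Gamma h -> phi (g * h)%g = (phi g * phi h)%g.
Implicit Types g h : isom R n.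

Let phiG g : Gamma g -> Gamma' (phi g).
Proof. by case: phi_bij => + _ _; apply. Qed.

Let phi_inj g h : Gamma g -> Gamma h -> phi g = phi h -> g = h.
Proof. by case: phi_bij => _ + _ Gg Gh; apply; exact: mem_set. Qed.

Let phi_surj k : Gamma' k -> exists2 g, Gamma g & phi g = k.
Proof. by case: phi_bij => _ _ + G'k; apply. Qed.

Lemma phi_is_trans g : Gamma g -> is_trans g <-> is_trans (phi g).
Proof.
move=> Gg; rewrite (is_trans_centralP dG cG Gg).
rewrite (is_trans_centralP dG' cG' (phiG Gg)).
split=> [gC h' /phi_surj[h Gh <-]|gC h Gh].
  have [k k0 ghk] := gC h Gh; exists k => //; have GX := subgroupX k Gh.
  by rewrite -(subgroup_morphX phiM) // -!phiM // ghk.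
have [k k0] := gC _ (phiG Gh); have GX := subgroupX k Gh.
rewrite -(subgroup_morphX phiM) // -!phiM // => /phi_inj ghk; exists k => //.
by apply: ghk; exact: subgroupM.
Qed.

Hypothesis phi_length : forall g, Gamma g -> geolength (phi g) = geolength g.

(** Polarization, from the lengths of [g], [h] and [g * h]. *)
Lemma dot_phi_trans g h : Gamma g -> Gamma h -> is_trans g -> is_trans h ->
  dot (trpart (phi g)) (trpart (phi h)) = dot (trpart g) (trpart h).
Proof.
move=> Gg Gh tg th.
have dotd d : Gamma d -> is_trans d ->
    dot (trpart (phi d)) (trpart (phi d)) = dot (trpart d) (trpart d).
  move=> Gd td; have := phi_length Gd; rewrite !geolength_trans //.
    by rewrite -!enorm_sqr => ->.
  exact/phi_is_trans.
have th' : is_trans (phi h) by exact/phi_is_trans.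
have := dotd _ (subgroupM Gg Gh) (is_transM tg th).
rewrite phiM // !trpart_transM // !dotDl !dotDr !dotd //.
by rewrite (dotC (trpart h)) (dotC (trpart (phi h))); lra.
Qed.

(** A basis of translations, the rows of [P], and its image, the rows of [Q], have equal Gram
    matrices; hence (P^-1 Q)^T preserves dot products. *)
Lemma lattice_isometry : exists T : 'M[R]_(n', n),
  [/\ T^T *m T = 1%:M, T *m T^T = 1%:M & forall g, Gamma g -> is_trans g ->
        trpart (phi g) = T *m trpart g].
Proof.
have [b [bP Pu]] := trans_basis dG cG; set P := \matrix_i _ in Pu.
pose Q := \matrix_(i < n) (trpart (phi (b i)))^T.
have QP g : Gamma g -> is_trans g -> Q *m trpart (phi g) = P *m trpart g.
  move=> Gg tg; apply/colP => i; have [Gb tb] := bP i.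
  have := dot_phi_trans Gb Gg tb tg; rewrite !dotE !mxE => dE.
  under eq_bigr => k _ do rewrite !mxE; rewrite dE.
  by apply: eq_bigr => k _; rewrite !mxE.
have gram : Q *m Q^T = P *m P^T.
  apply/matrixP => i j; have [Gi ti] := bP i; have [Gj tj] := bP j.
  have := dot_phi_trans Gi Gj ti tj; rewrite !dotE !mxE => dE.
  under eq_bigr => k _ do rewrite !mxE; rewrite dE.
  by apply: eq_bigr => k _; rewrite !mxE.
have Tb : (invmx P *m Q) *m (invmx P *m Q)^T = 1%:M.
  rewrite trmx_mul -mulmxA (mulmxA Q) gram mulmxA mulmxA mulVmx // mul1mx.
  by rewrite -trmx_mul mulVmx // trmx1.
pose T := (invmx P *m Q)^T; have TT : T^T *m T = 1%:M by rewrite trmxK.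
have Tphi g : Gamma g -> is_trans g -> trpart (phi g) = T *m trpart g.
  move=> Gg tg; set w := trpart (phi g); set v := trpart g.
  have TTw : T^T *m w = v by rewrite trmxK -mulmxA QP // mulmxA mulVmx // mul1mx.
  (* |w - T v|^2 expands to zero because T^T w = v and |w| = |v|. *)
  apply/eqP; rewrite -subr_eq0 -dot_eq0 dotBl !dotBr dot_mulmx //.
  have -> : dot w (T *m v) = dot v v by rewrite dotC /dot trmx_mul -mulmxA TTw.
  have -> : dot (T *m v) w = dot v v by rewrite /dot trmx_mul -mulmxA TTw.
  by rewrite (dot_phi_trans Gg Gg tg tg) -/v !subrr.
(* [n'] is not assumed equal to [n], so T T^T = 1 needs its own argument: T T^T fixes the
   translation vectors of [Gamma'], which span. *)
exists T; split=> //; apply/subr0_eq/(trans_span_mx dG' cG').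
move=> _ /phi_surj[g Gg <-] /(phi_is_trans Gg) tg.
by rewrite Tphi // mulmxBl mul1mx -!mulmxA (mulmxA T^T) TT mul1mx subrr.
Qed.

(** For [h] a translation by t, g h g^-1 has vector A t and its image under [phi] has vector B T t;
    such t span. *)
Lemma lattice_isometry_linpart (T : 'M[R]_(n', n)) :
  (forall g, Gamma g -> is_trans g -> trpart (phi g) = T *m trpart g) ->
  forall g, Gamma g -> T *m linpart g = linpart (phi g) *m T.
Proof.
move=> Tphi g Gg; apply/subr0_eq/(trans_span_mx dG cG) => h Gh th.
have th' : is_trans (phi h) by exact/phi_is_trans.
rewrite mulmxBl -!mulmxA -Tphi // -!trpart_transJ // -(subgroup_morphJ phiM) //.
rewrite -Tphi ?subrr //; last exact: is_transJ.
by apply: subgroupM; [exact: subgroupM|exact: subgroupV].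
Qed.

(* With F x = T x + c this asks that e g := T (g 0) - phi g 0, a cocycle that
   depends on [linpart g] only, be the coboundary of c; c is minus its average
   over the finite point group. *)
Lemma equivariant_isometry : exists (T : 'M[R]_(n', n)) c,
  [/\ T^T *m T = 1%:M, T *m T^T = 1%:M & forall g x, Gamma g ->
        T *m isom_act g x + c = isom_act (phi g) (T *m x + c)].
Proof.
have [T [TT TT' Tphi]] := lattice_isometry.
have TB := lattice_isometry_linpart Tphi.
pose e g := T *m isom_act g 0 - isom_act (phi g) 0.
have act0 m (k : isom R m) x : isom_act k x = isom_act k 0 + linpart k *m x.
  by rewrite -isom_actD add0r.
have eM g h : Gamma g -> Gamma h -> e (g * h)%g = e g + linpart (phi g) *m e h.
  move=> Gg Gh; rewrite /e phiM // !isom_act_mulg act0 [isom_act (phi g) _]act0.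
  by rewrite !mulmxDr mulmxN !mulmxA TB // opprD addrACA.
have e_trans g : Gamma g -> is_trans g -> e g = 0.
  move=> Gg tg; have tg' : is_trans (phi g) by exact/phi_is_trans.
  by rewrite /e !is_trans_act // !add0r Tphi // subrr.
(* Equal linear parts differ by a translation, where [e] vanishes. *)
have e_lin g h : Gamma g -> Gamma h -> linpart g = linpart h -> e g = e h.
  move=> Gg Gh gh; have GV := subgroupM (subgroupV Gg) Gh.
  have hE : (g * (g^-1 * h))%g = h by rewrite mulgA mulgV mul1g.
  rewrite -[in RHS]hE eM // (e_trans (g^-1 * h)%g) ?mulmx0 ?addr0 //.
  exact: linpart_eq_trans.
have [s0 s0P] := (finite_seqP _).1 (finite_point_group dG cG).
pose s := undup s0.
have sP A : (A \in s) = `[< [set linpart g | g in Gamma] A >].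
  by rewrite mem_undup s0P; apply/idP/asboolP.
(* A choice of group element over each linear part; the default is never reached on [s]. *)
pose r A := xget 1%g [set g | Gamma g /\ linpart g = A].
have rP A : [set linpart g | g in Gamma] A -> Gamma (r A) /\ linpart (r A) = A.
  by case=> g Gg gA; apply: (@xgetPex _ 1%g [set g | Gamma g /\ linpart g = A]); exists g.
pose N := (size s)%:R : R.
have N0 : N != 0.
  rewrite pnatr_eq0 -lt0n -has_predT; apply/hasP; exists 1%:M => //.
  by rewrite sP; apply/asboolP; exists 1%g; [exact: subgroup1|].
pose E := N^-1 *: \sum_(A <- s) e (r A).
(* Left multiplication by [linpart g] permutes the point group, so averaging the cocycle relation
   gives E = e g + B E. *)
have eE g : Gamma g -> e g = E - linpart (phi g) *m E.
  move=> Gg; apply/eqP; rewrite eq_sym subr_eq; apply/eqP.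
  have perm : perm_eq (map (mulmx (linpart g)) s) s.
    apply: uniq_perm; rewrite ?undup_uniq //.
      rewrite map_inj_uniq ?undup_uniq //.
      apply: (can_inj (g := mulmx (linpart g)^T)) => A.
      by rewrite mulmxA linpartTK mul1mx.
    move=> A; rewrite sP; apply/mapP/asboolP => [[B + ->]|[h Gh <-]].
      rewrite sP => /asboolP[h Gh <-].
      by exists (g * h)%g => //; exact: subgroupM.
    exists (linpart (g^-1 * h)%g).
      rewrite sP; apply/asboolP; exists (g^-1 * h)%g => //.
      by apply: subgroupM => //; exact: subgroupV.
    by rewrite linpartM linpartV mulmxA linpartKT mul1mx.
  rewrite {1}/E -(perm_big _ perm) /= big_map.
  rewrite (eq_big_seq (fun A => e g + linpart (phi g) *m e (r A))); last first.
    move=> A; rewrite sP => /asboolP[h Gh hA].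
    have [GrA rA] := rP A (ex_intro2 _ _ h Gh hA).
    have Ggh := subgroupM Gg GrA.
    have [|Gr lr] := rP (linpart g *m A).
      by exists (g * r A)%g; rewrite ?linpartM ?rA.
    by rewrite -eM //; apply: e_lin; rewrite ?lr ?linpartM ?rA.
  rewrite big_split /= big_const_seq count_predT iter_addr addr0 scalerDr.
  by rewrite -scaler_nat scalerA mulVf // scale1r -mulmx_sumr scalemxAr.
exists T, (- E); split=> // g x Gg.
have TE : T *m isom_act g 0 = E - linpart (phi g) *m E + isom_act (phi g) 0.
  by rewrite -eE // subrK.
rewrite act0 [isom_act (phi g) _]act0 !mulmxDr mulmxN TE.
rewrite (mulmxA T) TB // -mulmxA.
by apply/colP => i; rewrite !mxE; ring.
Qed.
End Rigidity.

(** * Descent of an equivariant isometry to the quotients *)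

Section EquivariantIsometry.
Variable R : realType.

Lemma local_lift_affine (m n : nat) (Gamma : subgroup (isom R m))
    (Gamma' : subgroup (isom R n)) (T : 'M[R]_(n, m)) c
    (f : flat_manifold Gamma -> flat_manifold Gamma') :
  (forall x, f (flat_proj Gamma x) = flat_proj Gamma' (T *m x + c)) ->
  forall x, local_lift f x (fun y => T *m y + c).
Proof.
move=> fT x; split; last by near=> y; rewrite fT.
by exists setT; [split=> //; exact: openT | move=> k; exact: affine_class_C].
Unshelve. all: by end_near. Qed.

(** Equivariance lets T x + c descend, and surjectivity of [phi] lets its inverse descend; both have
    global affine lifts. *)
Lemma isometric_of_equivariant (m n : nat) (Gamma : subgroup (isom R m))
    (Gamma' : subgroup (isom R n)) (phi : isom R m -> isom R n)
    (T : 'M[R]_(n, m)) c :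
  set_fun Gamma Gamma' phi -> set_surj Gamma Gamma' phi ->
  T^T *m T = 1%:M -> T *m T^T = 1%:M ->
  (forall g x, Gamma g ->
     T *m isom_act g x + c = isom_act (phi g) (T *m x + c)) ->
  isometric Gamma Gamma'.
Proof.
move=> phiG phi_surj TT TT' equiv.
pose F x := T *m x + c; pose F' y := T^T *m y + - (T^T *m c).
have FK : cancel F F' by move=> x; rewrite /F /F' mulmxDr mulmxA TT mul1mx addrK.
have F'K : cancel F' F.
  by move=> x; rewrite /F /F' mulmxDr mulmxN !mulmxA TT' !mul1mx subrK.
pose f (q : flat_manifold Gamma) := flat_proj Gamma' (F (repr q)).
pose h (q : flat_manifold Gamma') := flat_proj Gamma (F' (repr q)).
have repr_proj k (L : subgroup (isom R k)) x :
    exists2 g, L g & isom_act g x = repr (flat_proj L x).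
  by apply/flat_projP; rewrite eq_sym; apply/eqP; exact: reprK.
have fE x : f (flat_proj Gamma x) = flat_proj Gamma' (F x).
  have [g Gg gx] := repr_proj _ Gamma x; apply/eqP; rewrite eq_sym /f -gx.
  by apply/flat_projP; exists (phi g); [exact: phiG | rewrite -equiv].
have hE y : h (flat_proj Gamma' y) = flat_proj Gamma (F' y).
  have [g' Gg' gy] := repr_proj _ Gamma' y; apply/eqP; rewrite eq_sym /h -gy.
  have [g Gg gg'] := phi_surj _ Gg'; apply/flat_projP; exists g => //.
  by apply: (can_inj FK); rewrite F'K /F equiv // gg' -/(F _) F'K.
have projK k (L : subgroup (isom R k)) (q : flat_manifold L) :
    flat_proj L (repr q) = q by exact: reprK.
exists f, h; split.
- by move=> q; rewrite -(projK _ _ q) fE hE FK.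
- by move=> q; rewrite -(projK _ _ q) hE fE F'K.
- by move=> x; exists F; exact: local_lift_affine.
- by move=> y; exists F'; exact: local_lift_affine.
move=> x; exists F; first exact: local_lift_affine.
by move=> u v; rewrite !diff_affine dot_mulmx.
Qed.

End EquivariantIsometry.

Theorem proposition3p10 (R : realType) (n n' : nat)
    (Gamma : subgroup (isom R n)) (Gamma' : subgroup (isom R n'))
    (bGamma : bieberbach Gamma) (bGamma' : bieberbach Gamma')
    (phi : isom R n -> isom R n')
    (phi_bij : set_bij Gamma Gamma' phi)
    (phiM : forall g h, Gamma g -> Gamma h -> phi (g * h)%g = (phi g * phi h)%g)
    (phi_length : forall g, Gamma g -> geolength (phi g) = geolength g) :
  isometric Gamma Gamma'.
Proof.
have [dG cG _] := bGamma; have [dG' cG' _] := bGamma'.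
have [T [c [TT TT' equiv]]] :=
  equivariant_isometry dG cG dG' cG' phi_bij phiM phi_length.
have [phiG _ phi_surj] := phi_bij.
exact: isometric_of_equivariant phiG phi_surj TT TT' equiv.
Qed.
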